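(* Let $(X,\mathcal{A},\mu,T)$ be an ergodic probability preserving system and $(R_l)_{l\ge1}$ a sequence of Borel measurable maps $R_l:X\to\mathfrak{E}$ into a compact metric space $(\mathfrak{E},d_{\mathfrak{E}})$ which is asymptotically $T$-invariant in measure. Let $\mathfrak{K}$ be a compact set in $(\mathfrak{P},d_{\mathfrak{P}})$. Then $$\sup_{\nu,\overline\nu\in\mathfrak{K}}D_{\mathfrak{E}}(\mathrm{law}_\nu(R_l),\mathrm{law}_{\overline\nu}(R_l))\to0\qquad\text{as }l\to\infty.$$ Hence for any random element $R$ of $\mathfrak{E}$ and any two sequences $(\nu_l),(\overline\nu_l)$ in $\mathfrak{K}$, $R_l\overset{\overline\nu_l}{\Longrightarrow}R$ implies $R_l\overset{\nu_l}{\Longrightarrow}R$ as $l\to\infty$.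
   Context: $\mathfrak{P}$: probability measures $\nu\ll\mu$ on $(X,\mathcal{A})$ with $d_{\mathfrak{P}}(\nu,\nu')=2\sup_A|\nu(A)-\nu'(A)|$. $\mathrm{law}_\nu(R):=\nu\circ R^{-1}$. $(R_l)$ is asymptotically $T$-invariant in measure if $d_{\mathfrak{E}}(R_l\circ T,R_l)\to0$ in $\mu$-measure. $D_{\mathfrak{E}}$ is the metric on Borel probabilities on $\mathfrak{E}$ given by $D_{\mathfrak{E}}(Q,Q'):=\sum_{j\ge1}2^{-(j+1)}|\int\chi_j\,dQ-\int\chi_j\,dQ'|$, where $\chi_j=\vartheta_j/\sup|\vartheta_j|$ for a fixed sequence $(\vartheta_j)$ of Lipschitz functions dense in $\mathcal{C}(\mathfrak{E})$; it metrizes weak convergence. $\overset{\nu}{\Longrightarrow}$: weak convergence of laws under $\nu$. *)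

(* Defs.v *)
From HB Require Import structures.
From mathcomp Require Import all_boot all_order all_algebra.
From mathcomp Require Import all_classical all_reals all_analysis.
Set Implicit Arguments. Unset Strict Implicit. Unset Printing Implicit Defensive.
Import Order.TTheory GRing.Theory Num.Theory.
Import numFieldNormedType.Exports.
Local Open Scope classical_set_scope.
Local Open Scope ring_scope.

Section defs.
Context {R : realType}.

Definition borel_measurable {d} {X : measurableType d} {E : topologicalType}
  (f : X -> E) : Prop :=
  forall B : set E, <<s open >> B -> measurable (f @^-1` B).

Definition measure_preserving {d} {X : measurableType d}
  (mu : probability X R) (T : X -> X) : Prop :=
  measurable_fun setT T /\ forall A, measurable A -> mu (T @^-1` A) = mu A.

Definition ergodic {d} {X : measurableType d}
  (mu : probability X R) (T : X -> X) : Prop :=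
  forall A, measurable A -> T @^-1` A = A -> mu A = 0%E \/ mu A = 1%E.

Definition asympt_invariant_in_measure {d} {X : measurableType d}
  {E : metricType R} (mu : probability X R) (T : X -> X)
  (Rl : nat -> X -> E) : Prop :=
  forall eps : R, 0 < eps ->
    (fun l => mu [set x | eps < mdist (Rl l (T x)) (Rl l x)]) @ \oo --> 0%E.

Definition dP {d} {X : measurableType d} (nu nu' : probability X R) : R :=
  2 * sup [set `|fine (nu A) - fine (nu' A)| | A in (measurable : set (set X))].

Definition Pspace {d} {X : measurableType d} (mu : probability X R)
  : set (probability X R) := [set nu | nu `<< mu].

Definition dP_open {d} {X : measurableType d} (mu : probability X R)
  (U : set (probability X R)) : Prop :=
  U `<=` Pspace mu /\
  forall nu, U nu -> exists2 e : R, 0 < e &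
    forall nu', Pspace mu nu' -> dP nu nu' < e -> U nu'.

Definition dP_compact {d} {X : measurableType d} (mu : probability X R)
  (K : set (probability X R)) : Prop :=
  K `<=` Pspace mu /\
  forall (I : Type) (U : I -> set (probability X R)),
    (forall i, dP_open mu (U i)) -> K `<=` \bigcup_i U i ->
    exists2 F : set I, finite_set F & K `<=` \bigcup_(i in F) U i.

Definition lipschitz_fun {E : metricType R} (f : E -> R) : Prop :=
  exists k : R, forall x y, `|f x - f y| <= k * mdist x y.

Definition dense_lipschitz_seq {E : metricType R} (vt : nat -> E -> R) : Prop :=
  (forall j, lipschitz_fun (vt j)) /\
  forall f : E -> R, continuous f -> forall eps : R, 0 < eps ->
    exists j, forall x, `|f x - vt j x| < eps.

Definition chi {E : metricType R} (vt : nat -> E -> R) (j : nat) : E -> R :=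
  fun x => vt j x / sup (range (fun y => `|vt j y|)).

(* integral of g against law_nu(Rr) = nu o Rr^{-1}, i.e. int g o Rr dnu *)
Definition law_int {d} {X : measurableType d} {E : topologicalType}
  (nu : probability X R) (Rr : X -> E) (g : E -> R) : R :=
  Rintegral nu setT (g \o Rr).

Definition D_E {d} {X : measurableType d} {E : metricType R}
  (vt : nat -> E -> R) (nu nu' : probability X R) (Rr : X -> E) : R :=
  limn (series (fun j : nat =>
    (2 ^+ j.+1)^-1 * `|law_int nu Rr (chi vt j) - law_int nu' Rr (chi vt j)|)).

Definition weak_conv {d} {X : measurableType d} {E : topologicalType}
  {dO} {Omega : measurableType dO} (nul : nat -> probability X R)
  (Rl : nat -> X -> E) (P : probability Omega R) (Rlim : Omega -> E) : Prop :=
  forall f : E -> R, continuous f ->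
    (fun l => law_int (nul l) (Rl l) f) @ \oo --> law_int P Rlim f.

End defs.

(* Main.v *)
Require Import Defs.
From HB Require Import structures.
From mathcomp Require Import all_boot all_order all_algebra.
From mathcomp Require Import all_classical all_reals all_analysis.
From mathcomp Require Import measurable_realfun.
From mathcomp Require Import ring lra.
Import Order.TTheory GRing.Theory Num.Theory.
Import numFieldNormedType.Exports.
Local Open Scope classical_set_scope.
Local Open Scope ring_scope.

(**
For a Lipschitz function [f] put [F_l := f \o R_l]. Asymptotic invariance says
that [F_l \o T - F_l] tends to [0] in [L^1(mu)]; hence, for bounded [g] of mean
[0] and fixed [n], [\int g F_l dmu] differs from [\int (A_n g) F_l dmu] by
[o(1)], where [A_n g] is the Birkhoff average of [g]. Since [A_n g] tends to
[0] in [L^1(mu)] by ergodicity, [\int g F_l dmu] tends to [0]. Applied to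
truncated densities [dnu/dmu], this shows that [\int F_l dnu] and
[\int F_l dmu] are asymptotically equal for every [nu << mu]. Integrals of
uniformly bounded functions are Lipschitz in [nu] for the total variation
distance, so a finite net makes the convergence uniform on a compact set.

The mean ergodic theorem is obtained from Garsia's maximal inequality: the set
where the running maxima of the Birkhoff sums of [g] are unbounded is strictly
invariant, and if it had full measure then [\int g dmu >= 0]. So these maxima
are a.e. bounded as soon as [\int g dmu < 0], and one applies this to
[g - delta] and [- g - delta] for [g] of mean [0].
*)

(** Supplies a scale [t] at which an error [B * t] can be incurred four times within a tolerance
    [e]; dividing by [B + 1] covers [B = 0]. *)
Lemma small_factor {R : realFieldType} (B e : R) : 0 <= B -> 0 < e ->
  exists2 t, 0 < t & 4 * (B * t) <= e.
Proof.
move=> B0 e0; have B1 : 0 < 4 * (B + 1) by lra.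
exists (e / (4 * (B + 1))); first exact: divr_gt0.
by rewrite mulrA mulrA ler_pdivrMr//; nra.
Qed.

(** * Measurability of sets defined by comparing functions *)

Section measurable_sets.
Context {R : realType} {d : measure_display} {X : measurableType d}.
Implicit Types f g : X -> R.

Lemma measurable_set_ltr f g : measurable_fun setT f -> measurable_fun setT g ->
  measurable [set x | f x < g x].
Proof.
move=> mf mg; rewrite -[X in measurable X]setTI.
rewrite (_ : [set x | _] = (fun x => f x < g x) @^-1` [set true]).
  exact: measurable_fun_ltr.
by apply/seteqP; split.
Qed.

Lemma measurable_set_ler f g : measurable_fun setT f -> measurable_fun setT g ->
  measurable [set x | f x <= g x].
Proof.
move=> mf mg; rewrite -[X in measurable X]setTI.
rewrite (_ : [set x | _] = (fun x => f x <= g x) @^-1` [set true]).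
  exact: measurable_fun_ler.
by apply/seteqP; split.
Qed.

End measurable_sets.

(** * Calculus of integrals of bounded measurable functions *)

Section bounded_measurable.
Context {R : realType} {d : measure_display} {X : measurableType d}.
Implicit Types (f g : X -> R) (p : probability X R).

(** This class is closed under the operations used below and integrable against every probability
    measure, so the integral rules need no separate integrability conditions. *)
Definition bounded_measurable f : Prop :=
  measurable_fun setT f /\ exists B : R, forall x, `|f x| <= B.

Lemma bounded_measurable_cst (c : R) : bounded_measurable (fun=> c).
Proof. by split; [exact: measurable_cst|exists `|c|]. Qed.

Lemma bounded_measurableD f g : bounded_measurable f -> bounded_measurable g ->
  bounded_measurable (fun x => f x + g x).
Proof.
move=> [mf [B fB]] [mg [C gC]]; split; first exact: measurable_funD.
by exists (B + C) => x; rewrite (le_trans (ler_normD _ _))// lerD.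
Qed.

Lemma bounded_measurableM f g : bounded_measurable f -> bounded_measurable g ->
  bounded_measurable (fun x => f x * g x).
Proof.
move=> [mf [B fB]] [mg [C gC]]; split; first exact: measurable_funM.
by exists (B * C) => x; rewrite normrM ler_pM.
Qed.

Lemma bounded_measurableN f : bounded_measurable f ->
  bounded_measurable (fun x => - f x).
Proof.
move=> [mf [B fB]]; split; first exact: measurable_funN.
by exists B => x; rewrite normrN.
Qed.

Lemma bounded_measurableB f g : bounded_measurable f -> bounded_measurable g ->
  bounded_measurable (fun x => f x - g x).
Proof. by move=> ? /bounded_measurableN; exact: bounded_measurableD. Qed.

Lemma bounded_measurable_norm f : bounded_measurable f ->
  bounded_measurable (fun x => `|f x|).
Proof.
move=> [mf [B fB]]; split; first exact: measurableT_comp.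
by exists B => x; rewrite normr_id.
Qed.

Lemma bounded_measurable_max f g : bounded_measurable f ->
  bounded_measurable g -> bounded_measurable (fun x => Num.max (f x) (g x)).
Proof.
move=> [mf [B fB]] [mg [C gC]]; split; first exact: measurable_maxr.
exists (B + C) => x; have [_|_] := leP (f x) (g x).
  by rewrite (le_trans (gC x))// lerDr (le_trans _ (fB x)).
by rewrite (le_trans (fB x))// lerDl (le_trans _ (gC x)).
Qed.

Lemma bounded_measurable_indic (A : set X) : measurable A ->
  bounded_measurable (\1_A).
Proof.
move=> mA; split; first exact: measurable_indic.
by exists 1 => x; rewrite indicE ger0_norm// lern1 leq_b1.
Qed.

Lemma bounded_measurable_sum (n : nat) (f : nat -> X -> R) :
  (forall k, bounded_measurable (f k)) ->
  bounded_measurable (fun x => \sum_(k < n) f k x).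
Proof.
move=> bf; elim: n => [|n IH].
  under eq_fun do rewrite big_ord0; exact: bounded_measurable_cst.
by under eq_fun do rewrite big_ord_recr /=; exact: bounded_measurableD.
Qed.

Lemma bounded_measurable_comp f (T : X -> X) : measurable_fun setT T ->
  bounded_measurable f -> bounded_measurable (fun x => f (T x)).
Proof.
move=> mT [mf [B fB]]; split; first exact: (measurableT_comp mf mT).
by exists B => x.
Qed.

Lemma bounded_measurable_integrable p f : bounded_measurable f ->
  p.-integrable setT (EFin \o f).
Proof.
move=> [mf [B fB]]; apply: measurable_bounded_integrable => //.
  by rewrite ltey_eq fin_num_measure.
exists B; split; first exact: num_real.
by move=> M BM x _ /=; rewrite (le_trans (fB x))// ltW.
Qed.

Lemma bintegralD p f g : bounded_measurable f -> bounded_measurable g ->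
  \int[p]_x (f x + g x) = \int[p]_x f x + \int[p]_x g x.
Proof.
by move=> ? ?; rewrite RintegralD//;
  exact: bounded_measurable_integrable.
Qed.

Lemma bintegralB p f g : bounded_measurable f -> bounded_measurable g ->
  \int[p]_x (f x - g x) = \int[p]_x f x - \int[p]_x g x.
Proof.
by move=> ? ?; rewrite RintegralB//;
  exact: bounded_measurable_integrable.
Qed.

Lemma bintegralZl p f (c : R) : bounded_measurable f ->
  \int[p]_x (c * f x) = c * \int[p]_x f x.
Proof.
by move=> ?; rewrite RintegralZl//;
  exact: bounded_measurable_integrable.
Qed.

Lemma bintegralN p f : bounded_measurable f ->
  \int[p]_x (- f x) = - \int[p]_x f x.
Proof.
move=> bf; rewrite -[RHS]mulN1r -bintegralZl//.
by apply: eq_Rintegral => x _; rewrite mulN1r.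
Qed.

Lemma bintegral_cst p (c : R) : \int[p]_x c = c.
Proof. by rewrite Rintegral_cst//= probability_setT mulr1. Qed.

Lemma bintegral_sum p (n : nat) (f : nat -> X -> R) :
  (forall k, bounded_measurable (f k)) ->
  \int[p]_x (\sum_(k < n) f k x) = \sum_(k < n) \int[p]_x f k x.
Proof.
move=> bf; elim: n => [|n IH].
  by under eq_Rintegral do rewrite big_ord0; rewrite bintegral_cst big_ord0.
under eq_Rintegral do rewrite big_ord_recr /=.
by rewrite bintegralD ?IH ?big_ord_recr//; exact: bounded_measurable_sum.
Qed.

Lemma bintegral_le p f g : bounded_measurable f -> bounded_measurable g ->
  (forall x, f x <= g x) -> \int[p]_x f x <= \int[p]_x g x.
Proof.
by move=> ? ? fg; apply: le_Rintegral => //;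
  exact: bounded_measurable_integrable.
Qed.

Lemma bintegral_norm_le p f g : bounded_measurable f -> bounded_measurable g ->
  (forall x, `|f x| <= g x) -> `|\int[p]_x f x| <= \int[p]_x g x.
Proof.
move=> bf bg fg; rewrite ler_norml -bintegralN//; apply/andP; split.
  apply: bintegral_le => // [|x]; first exact: bounded_measurableN.
  by have := fg x; rewrite ler_norml => /andP[].
apply: bintegral_le => // x.
by have := fg x; rewrite ler_norml => /andP[].
Qed.

Lemma bintegral_norm_le_cst p f (B : R) : bounded_measurable f ->
  (forall x, `|f x| <= B) -> `|\int[p]_x f x| <= B.
Proof.
move=> bf fB; rewrite -[leRHS](bintegral_cst p).
by apply: bintegral_norm_le => //; exact: bounded_measurable_cst.
Qed.

Lemma bintegral_indic p (A : set X) : measurable A ->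
  \int[p]_x \1_A x = fine (p A).
Proof. by move=> mA; rewrite /Rintegral integral_indic// setIT. Qed.

Lemma bintegral_preserving p (T : X -> X) f : measure_preserving p T ->
  bounded_measurable f -> \int[p]_x f (T x) = \int[p]_x f x.
Proof.
move=> [mT pT] bf; rewrite /Rintegral; congr fine.
have -> : (\int[p]_x (f x)%:E = \int[pushforward p T]_x (f x)%:E)%E.
  by apply: eq_measure_integral => A mA _; exact: esym (pT A mA).
rewrite integral_pushforward//.
  by apply/measurable_EFinP; case: bf.
rewrite preimage_setT.
exact/bounded_measurable_integrable/bounded_measurable_comp.
Qed.

Lemma bounded_convergence p (f_ : nat -> X -> R) f (B : R) :
  (forall n, measurable_fun setT (f_ n)) -> measurable_fun setT f ->
  (forall n x, `|f_ n x| <= B) ->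
  {ae p, forall x, f_ n x @[n --> \oo] --> f x} ->
  \int[p]_x f_ n x @[n --> \oo] --> \int[p]_x f x.
Proof.
move=> mf_ mf fB ff.
have [|||||fi _ cf] := @dominated_convergence _ _ _ p setT measurableT
  (fun n x => (f_ n x)%:E) (fun x => (f x)%:E) (cst B%:E).
- by move=> n; exact/measurable_EFinP.
- exact/measurable_EFinP.
- apply: filterS ff => x fx _.
  exact: cvg_comp fx _.
- exact: finite_measure_integrable_cst.
- by apply: aeW => x n _; rewrite lee_fin.
- by apply: fine_cvg; rewrite fineK//; exact: integrable_fin_num.
Qed.

End bounded_measurable.

(** * Maximal and mean ergodic theorems, and asymptotic decorrelation *)

Section ergodic.
Context {R : realType} {d : measure_display} {X : measurableType d}.
Context (mu : probability X R) (T : X -> X) (mp : measure_preserving mu T).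
Implicit Types (f g : X -> R).

(* [max_(0 <= k <= n) \sum_(i < k) g (T^i x)], in the recursive form used by
   Garsia's proof of the maximal ergodic theorem. *)
Fixpoint birkhoff_max g (n : nat) (x : X) : R :=
  if n is m.+1 then Num.max 0 (g x + birkhoff_max g m (T x)) else 0.

Local Arguments birkhoff_max : simpl never.

Lemma birkhoff_max0 g x : birkhoff_max g 0 x = 0. Proof. by []. Qed.

Lemma birkhoff_maxS g n x :
  birkhoff_max g n.+1 x = Num.max 0 (g x + birkhoff_max g n (T x)).
Proof. by []. Qed.

Lemma birkhoff_max_ge0 g n x : 0 <= birkhoff_max g n x.
Proof. by case: n => [|n] //; rewrite birkhoff_maxS le_max lexx. Qed.

Lemma birkhoff_maxS_ge g n x :
  g x + birkhoff_max g n (T x) <= birkhoff_max g n.+1 x.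
Proof. by rewrite birkhoff_maxS le_max lexx orbT. Qed.

Lemma birkhoff_max_leS g n x : birkhoff_max g n x <= birkhoff_max g n.+1 x.
Proof.
elim: n x => [|n IH] x; first by rewrite birkhoff_max_ge0.
rewrite [leLHS]birkhoff_maxS ge_max birkhoff_max_ge0/=.
by rewrite (le_trans _ (birkhoff_maxS_ge _ _ _))// lerD2l.
Qed.

Lemma birkhoff_max_le_muln g (B : R) n x : (forall y, `|g y| <= B) ->
  birkhoff_max g n x <= n%:R * B.
Proof.
move=> gB; have B0 : 0 <= B := le_trans (normr_ge0 _) (gB x).
elim: n x => [|n IH] x; first by rewrite birkhoff_max0 mul0r.
rewrite birkhoff_maxS ge_max mulr_ge0//= -natr1 mulrDl mul1r addrC lerD//.
exact: le_trans (ler_norm _) (gB x).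
Qed.

(** The [n]-step Birkhoff sum of [g - c] is one of the competitors in its running maximum. *)
Lemma birkhoff_sum_le_max g (c : R) n x :
  \sum_(k < n) g (iter k T x) <= n%:R * c + birkhoff_max (fun y => g y - c) n x.
Proof.
elim: n x => [|n IH] x; first by rewrite big_ord0 birkhoff_max0 mul0r addr0.
rewrite big_ord_recl /=.
under eq_bigr do rewrite -iterS iterSr.
have := birkhoff_maxS_ge (fun y => g y - c) n x.
have := IH (T x); rewrite -natr1 mulrDl mul1r; lra.
Qed.

Lemma bounded_measurable_birkhoff_max g n : bounded_measurable g ->
  bounded_measurable (birkhoff_max g n).
Proof.
move=> bg; elim: n => [|n IH]; first exact: bounded_measurable_cst.
apply: bounded_measurable_max; first exact: bounded_measurable_cst.
apply: bounded_measurableD => //.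
by apply: bounded_measurable_comp => //; case: mp.
Qed.

Lemma bounded_measurable_iter g k : bounded_measurable g ->
  bounded_measurable (fun x => g (iter k T x)).
Proof.
move=> bg; elim: k => [|k IH]//.
under eq_fun do rewrite iterSr.
by apply: (bounded_measurable_comp (fun x => g (iter k T x))) => //; case: mp.
Qed.

Lemma measurable_birkhoff_max_gt g n (c : R) : bounded_measurable g ->
  measurable [set x | c < birkhoff_max g n x].
Proof.
move=> /(bounded_measurable_birkhoff_max _ n)[mM _].
exact: measurable_set_ltr.
Qed.

(** Write [M_n] for the running maximum. Where [M_(n+1) > 0], [g] equals [M_(n+1) - M_n \o T];
    elsewhere this difference is at most [0]. By invariance of [mu] it integrates to the integral of
    [M_(n+1) - M_n], which is nonnegative. *)
Lemma maximal_ergodic g n : bounded_measurable g ->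
  0 <= \int[mu]_x (g x * \1_[set y | 0 < birkhoff_max g n.+1 y] x).
Proof.
move=> bg; set A := [set y | _].
have bM k := bounded_measurable_birkhoff_max _ k bg.
have bMT : bounded_measurable (fun x => birkhoff_max g n (T x)).
  by apply: bounded_measurable_comp => //; case: mp.
have mA : measurable A by exact: measurable_birkhoff_max_gt.
apply: (@le_trans _ _
    (\int[mu]_x (birkhoff_max g n.+1 x - birkhoff_max g n (T x)))).
  rewrite bintegralB// (bintegral_preserving _ _ _ mp)// subr_ge0.
  by apply: bintegral_le => // x; exact: birkhoff_max_leS.
apply: bintegral_le => [||x].
- exact: bounded_measurableB.
- exact/bounded_measurableM/bounded_measurable_indic.
rewrite indicE; have [|Ax] := boolP (x \in A).
  rewrite inE /A /= !birkhoff_maxS mulr1 lt_max ltxx /= => gM.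
  by rewrite max_r ?addrK// ltW.
have M0 : birkhoff_max g n.+1 x <= 0.
  by rewrite leNgt; apply/negP => xA; move/negP: Ax; apply; rewrite inE.
by have := birkhoff_max_ge0 g n (T x); rewrite mulr0; lra.
Qed.

Context (erg : ergodic mu T).

(** Ergodicity enters here, through the set [G] of points whose maxima exceed every level;
    [mu G = 1] would contradict [maximal_ergodic] in the limit. *)
Lemma birkhoff_max_bounded_ae g : bounded_measurable g -> \int[mu]_x g x < 0 ->
  {ae mu, forall x, exists k : nat, forall n, birkhoff_max g n x <= k%:R}.
Proof.
move=> bg g0.
pose G := \bigcap_(k : nat) \bigcup_(n : nat)
  [set x | k%:R < birkhoff_max g n x].
have mG : measurable G.
  apply: bigcapT_measurable => k; apply: bigcup_measurable => n _.
  exact: measurable_birkhoff_max_gt.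
have [B gB] : exists B : nat, forall x, `|g x| <= B%:R.
  have [_ [B gB]] := bg; exists (Num.truncn B).+1 => x.
  by rewrite (le_trans (gB x))// ltW// truncnS_gt.
(* When positive, the maximum at [x] over [n.+1] steps differs from the one at [T x] over [n] steps
   by [g x]. Asking for level [k + B] on one side thus yields level [k] on the other. *)
have TG : T @^-1` G = G.
  apply/seteqP; split => x Gx k _.
    have [n _ /= kn] := Gx (k + B)%N I; exists n.+1 => //.
    apply: lt_le_trans (birkhoff_maxS_ge _ _ _).
    have := gB x; rewrite ler_norml => /andP[+ _]; move: kn; rewrite natrD; lra.
  have [[|n] _ /=] := Gx (k + B)%N I.
    by rewrite birkhoff_max0 ltNge ler0n.
  rewrite birkhoff_maxS lt_max ltNge ler0n /= => kn; exists n => //=.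
  have := gB x; rewrite ler_norml => /andP[_]; move: kn; rewrite natrD; lra.
have [G0|G1] := erg _ mG TG.
  exists G; split => // x /= Px k _; apply: contrapT => Gx; apply: Px.
  exists k => n; rewrite leNgt; apply/negP => kn; apply: Gx.
  by exists n.
exfalso; move: g0; apply/negP; rewrite -leNgt.
pose A n := [set y | 0 < birkhoff_max g n.+1 y].
have mA n : measurable (A n) by exact: measurable_birkhoff_max_gt.
have : \int[mu]_x (g x * \1_(A n) x) @[n --> \oo] --> \int[mu]_x g x.
  apply: (bounded_convergence _ _ _ B%:R).
  - by move=> n; apply: measurable_funM; [case: bg|exact: measurable_indic].
  - by case: bg.
  - move=> n x; rewrite normrM -[leRHS]mulr1 ler_pM//.
    by rewrite indicE ger0_norm// lern1 leq_b1.
  (* At a point of [G] some maximum is positive, and by monotonicity so are all later ones: the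
     indicator is eventually [1]. *)
  - exists (~` G); split; [exact: measurableC| |].
      by rewrite probability_setC// G1 subee.
    move=> x; apply: contra_not => /(_ 0%N I)[n _ /= Mn].
    apply: cvg_near_cst; exists n => // m /= nm.
    rewrite indicE mem_set ?mulr1// /A /=; apply: lt_le_trans Mn _.
    have /nondecreasing_seqP : forall k,
        birkhoff_max g k x <= birkhoff_max g k.+1 x.
      by move=> k; exact: birkhoff_max_leS.
    by apply; exact: leqW.
move=> cg; rewrite -(cvg_lim _ cg)//; apply: limr_ge.
  by apply/cvg_ex; eexists; exact: cg.
by apply: nearW => n; exact: maximal_ergodic.
Qed.

(** The maxima divided by the number of steps are bounded by [B] and tend to [0] wherever the maxima
    are bounded, hence almost everywhere; bounded convergence concludes. *)
Lemma birkhoff_max_mean g (e : R) : bounded_measurable g ->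
  \int[mu]_x g x < 0 -> 0 < e ->
  \forall n \near \oo, \int[mu]_x birkhoff_max g n.+1 x <= n.+1%:R * e.
Proof.
move=> bg g0 e0; have [_ [B gB]] := bg.
have bM k := bounded_measurable_birkhoff_max _ k bg.
have : \int[mu]_x (n.+1%:R^-1 * birkhoff_max g n.+1 x) @[n --> \oo] --> (0 : R).
  rewrite -[X in _ --> X](bintegral_cst mu).
  apply: (bounded_convergence _ _ _ B).
  - move=> n.
    by have [] := bounded_measurableM _ _
      (bounded_measurable_cst n.+1%:R^-1) (bM n.+1).
  - exact: measurable_cst.
  - move=> n x; rewrite normrM normfV normr_nat.
    rewrite (ger0_norm (birkhoff_max_ge0 _ _ _)).
    by rewrite mulrC ler_pdivrMr// mulrC birkhoff_max_le_muln.
  - apply: filterS (birkhoff_max_bounded_ae _ bg g0) => x [k Mk].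
    apply: (@squeeze_cvgr _ _ _ _ (cst 0) (fun n => n.+1%:R^-1 * k%:R)).
    + apply: nearW => n /=; rewrite mulr_ge0 ?birkhoff_max_ge0//=.
      by rewrite ler_wpM2l.
    + exact: cvg_cst.
    + rewrite -[X in _ --> X](mul0r k%:R).
      by apply: cvgM; [exact: cvg_harmonic|exact: cvg_cst].
move=> /cvgrPdist_le /(_ _ e0); apply: filterS => n.
rewrite sub0r normrN bintegralZl//; move/(le_trans (ler_norm _)).
by rewrite mulrC ler_pdivrMr// mulrC.
Qed.

(** Both [h] and [h'] have mean [- e / 3]. The absolute Birkhoff sum is at most [n.+1 * (e / 3)]
    plus their two maxima, each of which contributes a further third for large [n]. *)
Lemma mean_ergodic g (e : R) : bounded_measurable g -> \int[mu]_x g x = 0 ->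
  0 < e -> exists n : nat,
  \int[mu]_x `|\sum_(k < n.+1) g (iter k T x)| <= n.+1%:R * e.
Proof.
move=> bg g0 e0.
have e3 : 0 < e / 3 by lra.
pose h x := g x - e / 3; pose h' x := - g x - e / 3.
have bh : bounded_measurable h.
  by apply: bounded_measurableB => //; exact: bounded_measurable_cst.
have bh' : bounded_measurable h'.
  apply: bounded_measurableB; first exact: bounded_measurableN.
  exact: bounded_measurable_cst.
have ih : \int[mu]_x h x < 0.
  rewrite bintegralB ?bintegral_cst ?g0//; first lra.
  exact: bounded_measurable_cst.
have ih' : \int[mu]_x h' x < 0.
  rewrite bintegralB ?bintegralN ?bintegral_cst ?g0//; first lra.
  - exact: bounded_measurableN.
  - exact: bounded_measurable_cst.
near \oo => n; exists n.
have M1 : \int[mu]_x birkhoff_max h n.+1 x <= n.+1%:R * (e / 3).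
  by near: n; exact: birkhoff_max_mean.
have M2 : \int[mu]_x birkhoff_max h' n.+1 x <= n.+1%:R * (e / 3).
  by near: n; exact: birkhoff_max_mean.
have bM1 := bounded_measurable_birkhoff_max _ n.+1 bh.
have bM2 := bounded_measurable_birkhoff_max _ n.+1 bh'.
have bS : bounded_measurable (fun x => \sum_(k < n.+1) g (iter k T x)).
  apply: (bounded_measurable_sum _ (fun k x => g (iter k T x))) => k.
  exact: bounded_measurable_iter.
apply: (@le_trans _ _ (\int[mu]_x (n.+1%:R * (e / 3) +
    (birkhoff_max h n.+1 x + birkhoff_max h' n.+1 x)))).
  apply: bintegral_le => [||x].
  - exact: bounded_measurable_norm.
  - apply: bounded_measurableD; first exact: bounded_measurable_cst.
    exact: bounded_measurableD.
  have S1 := birkhoff_sum_le_max g (e / 3) n.+1 x.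
  have S2 := birkhoff_sum_le_max (fun x => - g x) (e / 3) n.+1 x.
  rewrite sumrN in S2.
  rewrite ler_norml; have := birkhoff_max_ge0 h n.+1 x.
  have := birkhoff_max_ge0 h' n.+1 x; rewrite -/h in S1; rewrite -/h' in S2.
  by move=> H1 H2; apply/andP; split; lra.
rewrite bintegralD ?bintegral_cst//; last 2 first.
- exact: bounded_measurable_cst.
- exact: bounded_measurableD.
rewrite bintegralD//; lra.
Unshelve. all: by end_near. Qed.

(** Invariance turns the integral of [(g \o T^k) * f] into that of [(g \o T^(k+1)) * (f \o T)];
    replacing [f \o T] by [f] costs one summand of the bound. *)
Lemma integral_shift_dist g f (M : R) k : bounded_measurable g ->
  bounded_measurable f -> (forall x, `|g x| <= M) ->
  `|\int[mu]_x (g x * f x) - \int[mu]_x (g (iter k T x) * f x)| <=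
  k%:R * (M * \int[mu]_x `|f (T x) - f x|).
Proof.
move=> bg bf gM; elim: k => [|k IH]; first by rewrite subrr normr0 mul0r.
have [mT _] := mp.
have bgk j := bounded_measurable_iter _ j bg.
have bfT := bounded_measurable_comp _ _ mT bf.
set a := \int[mu]_x _ in IH *; set b := \int[mu]_x _ in IH.
set c := (X in `|a - X|).
suff : `|b - c| <= M * \int[mu]_x `|f (T x) - f x|.
  move=> bc; rewrite -(subrKA b) (le_trans (ler_normD _ _))//.
  by rewrite -natr1 mulrDl mul1r; apply: lerD.
have -> : b = \int[mu]_x (g (iter k.+1 T x) * f (T x)).
  rewrite /b -(bintegral_preserving _ _ (fun x => g (iter k T x) * f x) mp).
    by apply: eq_Rintegral => x _; rewrite iterSr.
  exact: bounded_measurableM.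
rewrite -bintegralB; [|exact: bounded_measurableM|exact: bounded_measurableM].
rewrite -bintegralZl; last first.
  by apply: bounded_measurable_norm; exact: bounded_measurableB.
apply: bintegral_norm_le => [||x].
- by apply: bounded_measurableB; exact: bounded_measurableM.
- apply: bounded_measurableM; first exact: bounded_measurable_cst.
  by apply: bounded_measurable_norm; exact: bounded_measurableB.
by rewrite -mulrBr normrM ler_wpM2r.
Qed.

Lemma asymptotic_decorrelation g (F : nat -> X -> R) (B : R) :
  bounded_measurable g -> \int[mu]_x g x = 0 ->
  (forall l, measurable_fun setT (F l)) -> (forall l x, `|F l x| <= B) ->
  \int[mu]_x `|F l (T x) - F l x| @[l --> \oo] --> (0 : R) ->
  \int[mu]_x (g x * F l x) @[l --> \oo] --> (0 : R).
Proof.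
move=> bg g0 mF FB FT; apply/cvgrPdist_le => e e0.
have bF l : bounded_measurable (F l) by split => //; exists B.
have [_ [M' gM']] := bg.
pose M := `|M'| + 1.
have M0 : 0 < M by rewrite ltr_pwDr.
have gM x : `|g x| <= M.
  by rewrite (le_trans (gM' x))// (le_trans (ler_norm _))// lerDl.
have B0 : 0 <= B.
  exact: le_trans (normr_ge0 _) (bintegral_norm_le_cst mu _ _ (bF 0%N) (FB 0%N)).
(* The averaging length [n] is fixed first, from [e']; only then is [e''] chosen, depending on [n],
   to make the [n.+1] shifts cheap for large [l]. *)
have e' : 0 < e / 2 / (B + 1) by rewrite !divr_gt0// ltr_wpDl.
have [n Sn] := mean_ergodic g _ bg g0 e'.
have e'' : 0 < e / 2 / (n.+1%:R * M) by rewrite !divr_gt0// mulr_gt0.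
move/cvgrPdist_le : FT => /(_ _ e''); apply: filterS => l.
rewrite !sub0r !normrN => dl.
have {}dl := le_trans (ler_norm _) dl.
set D := Rintegral _ _ _ in dl.
set I := Rintegral _ _ _.
pose J k := \int[mu]_x (g (iter k T x) * F l x).
pose N : R := n.+1%:R.
have N0 : 0 < N by rewrite ltr0n.
have bgF k : bounded_measurable (fun x => g (iter k T x) * F l x).
  by apply: bounded_measurableM => //; exact: bounded_measurable_iter.
have bS : bounded_measurable (fun x => \sum_(k < n.+1) g (iter k T x)).
  apply: (bounded_measurable_sum _ (fun k x => g (iter k T x))) => k.
  exact: bounded_measurable_iter.
have NMD : N * (M * D) <= e / 2.
  by move: dl; rewrite ler_pdivlMr ?mulr_gt0// mulrC -mulrA.
(* The first sum is controlled by almost invariance of [F l], the second by the mean ergodic theorem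
   for [g]; each is at most [N * (e / 2)]. *)
have NI : N * I = \sum_(k < n.+1) (I - J k) + \sum_(k < n.+1) J k.
  rewrite -big_split/=; under eq_bigr do rewrite subrK.
  by rewrite sumr_const card_ord mulr_natl.
have S1 : `|\sum_(k < n.+1) (I - J k)| <= N * (e / 2).
  apply: le_trans (ler_norm_sum _ _ _) _.
  apply: (@le_trans _ _ (\sum_(k < n.+1) (e / 2))); last first.
    by rewrite sumr_const card_ord mulr_natl.
  apply: ler_sum => k _; apply: le_trans NMD.
  apply: le_trans (integral_shift_dist _ _ M k bg (bF l) gM) _.
  rewrite ler_wpM2r//; last by rewrite ler_nat ltnW.
  by rewrite mulr_ge0 ?(ltW M0)//; apply: Rintegral_ge0.
have S2 : `|\sum_(k < n.+1) J k| <= N * (e / 2).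
  rewrite /J -(bintegral_sum _ _ (fun k x => g (iter k T x) * F l x))//.
  apply: (@le_trans _ _ (\int[mu]_x (B * `|\sum_(k < n.+1) g (iter k T x)|))).
    apply: bintegral_norm_le => [||x].
    - exact: (bounded_measurable_sum _ (fun k x => g (iter k T x) * F l x)).
    - apply: bounded_measurableM; first exact: bounded_measurable_cst.
      exact: bounded_measurable_norm.
    by rewrite -mulr_suml normrM mulrC ler_wpM2r.
  rewrite bintegralZl; last exact: bounded_measurable_norm.
  apply: le_trans (ler_wpM2l B0 Sn) _.
  rewrite mulrCA ler_wpM2l ?(ltW N0)// mulrA ler_pdivrMr; last lra.
  by rewrite mulrDr mulr1 [leLHS]mulrC lerDl; lra.
rewrite -(ler_pM2l N0) -{1}(gtr0_norm N0) -normrM NI.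
by rewrite (le_trans (ler_normD _ _))//; lra.
Qed.

End ergodic.

(** * Absolutely continuous measures, total variation and compact families *)

Section domination.
Context {R : realType} {d : measure_display} {X : measurableType d}.
Implicit Types (mu nu : probability X R) (f g : X -> R).

(* The witness is the Radon-Nikodym derivative cut off at a large level. *)
Lemma approx_density mu nu (e : R) : nu `<< mu -> 0 < e ->
  exists2 g, bounded_measurable g &
  forall f (B : R), bounded_measurable f -> (forall x, `|f x| <= B) ->
    `|\int[nu]_x f x - \int[mu]_x (f x * g x)| <= B * e.
Proof.
move=> numu e0.
pose H : X -> \bar R := Radon_Nikodym (charge_of_finite_measure nu) mu.
have fH x : H x \is a fin_num by exact: Radon_Nikodym_fin_num.
pose h x := fine (H x).
have mh : measurable_fun setT h.
  apply: measurableT_comp; first exact: fine_measurable.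
  by apply: (measurable_int mu); exact: Radon_Nikodym_integrable.
pose A n := [set x | `|h x| <= n%:R].
have mA (n : nat) : measurable (A n).
  by apply: measurable_set_ler => //; exact: measurableT_comp.
(* Since [h] is finite everywhere, each point eventually enters [A n], so a level exists beyond
   which [nu] has mass at most [e]. *)
have : \int[nu]_x \1_(~` A n) x @[n --> \oo] --> (0 : R).
  rewrite -[X in _ --> X](bintegral_cst nu).
  apply: (bounded_convergence _ _ _ 1).
  - by move=> n; apply: measurable_indic; exact: measurableC.
  - exact: measurable_cst.
  - by move=> n x; rewrite indicE ger0_norm// lern1 leq_b1.
  - apply: aeW => x; apply: cvg_near_cst.
    exists (Num.truncn `|h x|).+1 => // n /= hn.
    rewrite indicE memNset//=; apply; rewrite /A /=.
    by rewrite (le_trans (ltW (truncnS_gt _)))// ler_nat.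
move=> /cvgrPdist_le /(_ _ e0)[n _ /(_ n)].
rewrite /= leqnn sub0r normrN => /(_ isT) An.
pose g x := h x * \1_(A n) x.
have bg : bounded_measurable g.
  split; first exact: measurable_funM.
  exists n%:R => x; rewrite /g indicE; have [|_] := boolP (x \in A n).
    by rewrite inE mulr1.
  by rewrite mulr0 normr0.
exists g => // f B bf fB.
have bA := bounded_measurable_indic _ (mA n).
have bAC := bounded_measurable_indic _ (measurableC (mA n)).
(* Integrating against the truncated density is integrating against [nu] on [A n], so the error is
   the part of [f] outside [A n]. *)
have -> : \int[mu]_x (f x * g x) = \int[nu]_x (f x * \1_(A n) x).
  rewrite /Rintegral; congr fine.
  rewrite -(Radon_Nikodym_change_of_variables numu)//; last first.
    by apply: bounded_measurable_integrable; exact: bounded_measurableM.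
  apply: eq_integral => x _.
  rewrite [X in (_ * X)%E](_ : _ = (h x)%:E); last exact/esym/fineK/fH.
  by rewrite -EFinM /g; congr EFin; ring.
rewrite -bintegralB//; last exact: bounded_measurableM.
apply: (@le_trans _ _ (\int[nu]_x (B * \1_(~` A n) x))).
  apply: bintegral_norm_le => [||x].
  - by apply: bounded_measurableB => //; exact: bounded_measurableM.
  - by apply: bounded_measurableM => //; exact: bounded_measurable_cst.
  have -> : f x - f x * \1_(A n) x = f x * \1_(~` A n) x.
    by rewrite !indicE in_setC; case: (x \in A n) => /=; ring.
  by rewrite normrM [X in _ * X]ger0_norm indicE// ler_wpM2r.
rewrite bintegralZl//.
have B0 := le_trans (normr_ge0 _) (bintegral_norm_le_cst nu _ _ bf fB).
by rewrite ler_wpM2l// (le_trans (ler_norm _)).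
Qed.

(** Ensures that the [sup] in [dP] is a genuine supremum. *)
Lemma has_sup_dP nu nu' :
  has_sup [set `|fine (nu A) - fine (nu' A)| | A in (measurable : set (set X))].
Proof.
split; first by exists `|fine (nu set0) - fine (nu' set0)|, set0.
exists 1 => _ [A mA <-].
have p01 (p : probability X R) : 0 <= fine (p A) <= 1.
  rewrite fine_ge0 ?measure_ge0//= -[1]/(fine 1%E) fine_le//.
  - exact: fin_num_measure.
  - exact: probability_le1.
have /andP[? ?] := p01 nu; have /andP[? ?] := p01 nu'.
by rewrite ler_norml; apply/andP; split; lra.
Qed.

Lemma le_dP nu nu' A : measurable A ->
  `|fine (nu A) - fine (nu' A)| <= dP nu nu' / 2.
Proof.
move=> mA; rewrite /dP mulrAC divff// mul1r.
by apply: sup_upper_bound; [exact: has_sup_dP|exists A].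
Qed.

Lemma dP_le nu nu' (c : R) :
  (forall A, measurable A -> `|fine (nu A) - fine (nu' A)| <= c / 2) ->
  dP nu nu' <= c.
Proof.
move=> nuc; rewrite /dP mulrC -ler_pdivlMr//; apply: ge_sup.
  by have [] := has_sup_dP nu nu'.
by move=> _ [A mA <-]; exact: nuc.
Qed.

Lemma dP_triangle nu1 nu2 nu3 : dP nu1 nu3 <= dP nu1 nu2 + dP nu2 nu3.
Proof.
apply: dP_le => A mA; rewrite -(subrKA (fine (nu2 A))) mulrDl.
by apply: le_trans (ler_normD _ _) _; apply: lerD; exact: le_dP.
Qed.

Lemma dPxx nu : dP nu nu <= 0.
Proof. by apply: dP_le => A mA; rewrite subrr normr0 mul0r. Qed.

(** Through approximate densities [g] and [g'] the left side is at most [B] times the [L^1] norm of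
    [g - g'], up to [2 * (B * e')]. That norm is attained by testing [g - g'] against its sign. *)
Lemma integral_dist_le_dP mu nu nu' f (B : R) : nu `<< mu -> nu' `<< mu ->
  bounded_measurable f -> (forall x, `|f x| <= B) ->
  `|\int[nu]_x f x - \int[nu']_x f x| <= B * dP nu nu'.
Proof.
move=> numu numu' bf fB.
have B0 := le_trans (normr_ge0 _) (bintegral_norm_le_cst nu _ _ bf fB).
apply/ler_addgt0Pl => e e0.
have [e' e'0 Be] := small_factor _ _ B0 e0.
have [g bg gnu] := approx_density _ _ _ numu e'0.
have [g' bg' gnu'] := approx_density _ _ _ numu' e'0.
have bgg' := bounded_measurableB _ _ bg bg'.
pose P := [set x | g' x <= g x].
have mP : measurable P.
  by case: bg bg' => mg _ [mg' _]; exact: measurable_set_ler.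
have bP := bounded_measurable_indic _ mP.
have bPC := bounded_measurable_indic _ (measurableC mP).
pose s x : R := \1_P x - \1_(~` P) x.
have bs : bounded_measurable s by exact: bounded_measurableB.
have s1 x : `|s x| <= 1.
  rewrite /s !indicE in_setC; case: (x \in P) => /=.
    by rewrite subr0 normr1.
  by rewrite sub0r normrN normr1.
have sE (p : probability X R) : \int[p]_x s x = fine (p P) - fine (p (~` P)).
  by rewrite bintegralB// !bintegral_indic//; exact: measurableC.
have sgg' x : `|g x - g' x| = s x * g x - s x * g' x.
  rewrite -mulrBr /s !indicE in_setC; have [|Px] := boolP (x \in P).
    by rewrite inE /P /= => Px; rewrite subr0 mul1r ger0_norm// subr_ge0.
  have /ltW gg' : g x < g' x.
    by rewrite ltNge; apply/negP => xP; move/negP: Px; apply; rewrite inE.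
  by rewrite ler0_norm ?subr_le0//= sub0r mulN1r.
have fgg' : `|\int[mu]_x (f x * g x) - \int[mu]_x (f x * g' x)| <=
    B * \int[mu]_x `|g x - g' x|.
  rewrite -bintegralB; [|exact: bounded_measurableM..].
  rewrite -bintegralZl; last exact: bounded_measurable_norm.
  apply: bintegral_norm_le => [||x].
  - by apply: bounded_measurableB; exact: bounded_measurableM.
  - apply: bounded_measurableM; first exact: bounded_measurable_cst.
    exact: bounded_measurable_norm.
  by rewrite -mulrBr normrM ler_wpM2r.
(* The discrepancies on [P] and on its complement are each at most half of [dP]; replacing each
   density by its measure costs [e']. With the two errors for [f] this makes four times [B * e']. *)
have tv : \int[mu]_x `|g x - g' x| <= dP nu nu' + 2 * e'.
  under eq_Rintegral do rewrite sgg'.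
  rewrite bintegralB; [|exact: bounded_measurableM..].
  have := gnu _ _ bs s1; have := gnu' _ _ bs s1; rewrite !sE mul1r.
  have := le_dP nu nu' _ mP; have := le_dP nu nu' _ (measurableC mP).
  rewrite !ler_norml => /andP[? ?] /andP[? ?] /andP[? ?] /andP[? ?].
  lra.
have := gnu _ _ bf fB; have := gnu' _ _ bf fB.
have := ler_wpM2l B0 tv => tv' H1 H2.
move: fgg' H1 H2 tv' Be; rewrite !ler_norml mulrDr.
move=> /andP[? ?] /andP[? ?] /andP[? ?] ? ?; apply/andP; split; lra.
Qed.

(** Compactness is applied to the cover by balls about arbitrary centres, a ball being empty unless
    its centre is absolutely continuous. The [{classic _}] index type lets the finite set of centres
    be enumerated later. *)
Lemma dP_compact_net mu (K : set (probability X R)) (e : R) :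
  dP_compact mu K -> 0 < e ->
  exists2 F : set {classic probability X R}, finite_set F &
  forall nu, K nu -> exists nu0 : probability X R,
    [/\ F nu0, nu0 `<< mu & dP nu0 nu < e].
Proof.
move=> [Kmu cK] e0.
have [i|nu Knu|F fF KF] := cK {classic probability X R}
  (fun nu0 : probability X R => [set nu : probability X R |
     [/\ nu0 `<< mu, nu `<< mu & dP nu0 nu < e]]).
- split=> [nu [_ //]|nu [imu numu inu]].
  exists (e - dP i nu); first by rewrite subr_gt0.
  move=> nu' nu'mu nunu'; split => //.
  by apply: le_lt_trans (dP_triangle _ nu _) _; rewrite -ltrBrDl.
- exists nu => //; split; [exact: Kmu|exact: Kmu|].
  exact: le_lt_trans (dPxx _) e0.
exists F => // nu /KF[nu0 Fnu0 [nu0mu numu dnu]].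
by exists nu0; split.
Qed.

(** With an approximate density [g] of [nu] and its mean [m], decorrelation applies to [g - m]. What
    remains is the approximation error and [1 - m], both of order [e']. *)
Lemma asymptotic_law mu nu (T : X -> X) (F : nat -> X -> R) (B : R) :
  measure_preserving mu T -> ergodic mu T -> nu `<< mu ->
  (forall l, measurable_fun setT (F l)) -> (forall l x, `|F l x| <= B) ->
  \int[mu]_x `|F l (T x) - F l x| @[l --> \oo] --> (0 : R) ->
  \int[nu]_x F l x - \int[mu]_x F l x @[l --> \oo] --> (0 : R).
Proof.
move=> mp erg numu mF FB FT; apply/cvgrPdist_le => e e0.
have bF l : bounded_measurable (F l) by split => //; exists B.
have B0 : 0 <= B.
  exact: le_trans (normr_ge0 _) (bintegral_norm_le_cst nu _ _ (bF 0%N) (FB 0%N)).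
have [e' e'0 Be] := small_factor _ _ B0 e0.
have [g bg gnu] := approx_density _ _ _ numu e'0.
pose m := \int[mu]_x g x.
(* The approximation property of [g], tested on the constant [1]. *)
have m1 : `|1 - m| <= e'.
  have := gnu (fun=> 1) 1 (bounded_measurable_cst 1).
  rewrite bintegral_cst mul1r; under eq_Rintegral do rewrite mul1r.
  by apply=> _; rewrite normr1.
have bgm : bounded_measurable (fun x => g x - m).
  by apply: bounded_measurableB => //; exact: bounded_measurable_cst.
have e2 : 0 < e / 2 by lra.
have gm0 : \int[mu]_x (g x - m) = 0.
  by rewrite bintegralB ?bintegral_cst ?subrr//; exact: bounded_measurable_cst.
have := asymptotic_decorrelation _ _ mp erg _ _ _ bgm gm0 mF FB FT.
move=> /cvgrPdist_le /(_ _ e2); apply: filterS => l.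
rewrite !sub0r !normrN => gF.
have -> : \int[nu]_x F l x - \int[mu]_x F l x =
    (\int[nu]_x F l x - \int[mu]_x (F l x * g x)) +
    (\int[mu]_x ((g x - m) * F l x) - (1 - m) * \int[mu]_x F l x).
  have -> : \int[mu]_x ((g x - m) * F l x) =
      \int[mu]_x (F l x * g x) - m * \int[mu]_x F l x.
    rewrite -bintegralZl// -bintegralB; last 2 first.
    - exact: bounded_measurableM.
    - by apply: bounded_measurableM => //; exact: bounded_measurable_cst.
    by apply: eq_Rintegral => x _; ring.
  ring.
have mF' : `|(1 - m) * \int[mu]_x F l x| <= e' * B.
  by rewrite normrM ler_pM//; exact: bintegral_norm_le_cst.
have gFl := gnu _ _ (bF l) (FB l).
apply: le_trans (ler_normD _ _) _; apply: le_trans (lerD gFl (ler_normB _ _)) _.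
by apply: le_trans (lerD (lexx _) (lerD gF mF')) _; lra.
Qed.

(** Each measure of [K] is compared with a centre of a finite net (cost [e / 4]), the centre with
    [mu] (again [e / 4]), and two measures of [K] with each other through [mu]. *)
Lemma asymptotic_law_uniform mu (T : X -> X) (F : nat -> X -> R) (B e : R)
    (K : set (probability X R)) :
  measure_preserving mu T -> ergodic mu T -> dP_compact mu K ->
  (forall l, measurable_fun setT (F l)) -> (forall l x, `|F l x| <= B) ->
  \int[mu]_x `|F l (T x) - F l x| @[l --> \oo] --> (0 : R) -> 0 < e ->
  \forall l \near \oo, forall nu nu', K nu -> K nu' ->
    `|\int[nu]_x F l x - \int[nu']_x F l x| <= e.
Proof.
move=> mp erg cK mF FB FT e0.
have bF l : bounded_measurable (F l) by split => //; exists B.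
have B0 : 0 <= B.
  exact: le_trans (normr_ge0 _) (bintegral_norm_le_cst mu _ _ (bF 0%N) (FB 0%N)).
have [e' e'0 Be] := small_factor _ _ B0 e0.
have [G /finite_fsetP[S GS] netG] := dP_compact_net _ _ _ cK e'0.
(* The premise makes [Q] trivial at members of the net that are not absolutely continuous. *)
pose Q (nu0 : {classic probability X R}) : set nat :=
  [set l | nu0 `<< mu -> `|\int[nu0]_x F l x - \int[mu]_x F l x| <= e / 4].
have e4 : 0 < e / 4 by lra.
have : \forall l \near \oo, (\bigcap_(nu0 in G) Q nu0) l.
  rewrite GS; apply: filter_bigI => nu0 _.
  have [numu|nnumu] := pselect ((nu0 : probability X R) `<< mu); last first.
    by exists 0%N => // l _ /nnumu.
  have := asymptotic_law _ _ _ _ _ mp erg numu mF FB FT.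
  move=> /cvgrPdist_le /(_ _ e4); apply: filterS => l.
  by rewrite sub0r normrN => Fl _.
apply: filterS => l Ql.
suff Kmu nu : K nu -> `|\int[nu]_x F l x - \int[mu]_x F l x| <= e / 2.
  move=> nu nu' /Kmu H /Kmu H'; rewrite -(subrKA (\int[mu]_x F l x)).
  apply: le_trans (ler_normD _ _) _.
  by rewrite [X in _ + X]distrC; lra.
move=> Knu; have [nu0 [Gnu0 nu0mu dnu]] := netG _ Knu.
rewrite -(subrKA (\int[nu0]_x F l x)); apply: le_trans (ler_normD _ _) _.
have numu : nu `<< mu by case: cK => + _; exact.
have H1 := integral_dist_le_dP _ _ _ _ _ nu0mu numu (bF l) (FB l).
have H2 : `|\int[nu0]_x F l x - \int[mu]_x F l x| <= e / 4.
  by exact: (Ql nu0).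
have H3 := ler_wpM2l B0 (ltW dnu).
by rewrite distrC; lra.
Qed.


End domination.

(** * Lipschitz test functions and random elements of a compact metric space *)

Section compact_metric.
Context {R : realType} {E : metricType R}.
Implicit Types f : E -> R.

Lemma lipschitz_continuous f : lipschitz_fun f -> continuous f.
Proof.
move=> [k fk] x; apply/cvgrPdist_le => e e0; near=> y.
apply: le_trans (fk x y) _.
(* The constant [k] carries no sign, so a positive one replaces it before dividing. *)
apply: (@le_trans _ _ ((`|k| + 1) * mdist x y)).
  by rewrite ler_wpM2r ?mdist_ge0// (le_trans (ler_norm _))// lerDl.
have k0 : 0 < `|k| + 1 by rewrite ltr_wpDl.
rewrite mulrC -ler_pdivlMr// ltW//.
have : ball x (e / (`|k| + 1)) y by near: y; apply: nbhsx_ballx; exact: divr_gt0.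
by rewrite ballEmdist.
Unshelve. all: by end_near. Qed.

Lemma lipschitz_mdist (y : E) : lipschitz_fun (fun x => mdist x y).
Proof.
exists 1 => a b; rewrite mul1r ler_norml.
have := metric_triangle a b y; have := metric_triangle b a y.
rewrite (metric_sym b a) => H1 H2; apply/andP; split; lra.
Qed.

Lemma compact_bounded_fun f : compact [set: E] -> continuous f ->
  exists B : R, forall x, `|f x| <= B.
Proof.
move=> cE cf.
have /compact_bounded[M [_ fM]] : compact (range f).
  by apply: continuous_compact => //; exact: continuous_subspaceT.
exists (M + 1) => x; apply: (fM (M + 1)); first by rewrite ltrDl.
by exists x.
Qed.

Lemma measurable_fun_comp_borel {d} {X : measurableType d} (r : X -> E) f :
  borel_measurable r -> continuous f -> measurable_fun setT (f \o r).
Proof.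
move=> br cf.
apply: (measurability _ (RGenOpens.measurableE R)) => /= _ [_ [a [b ->]] <-].
rewrite setTI comp_preimage; apply: br; apply: sub_sigma_algebra.
by apply: open_comp => // x _; exact: cf.
Qed.

(* The dense sequence replaces separability: [mdist a b] is the supremum of
   [|vt j a - vt j b|] over the almost 1-Lipschitz members of the sequence. *)
Lemma measurable_mdist_gt {d} {X : measurableType d} (vt : nat -> E -> R)
    (r r' : X -> E) (e : R) :
  dense_lipschitz_seq vt -> borel_measurable r -> borel_measurable r' ->
  measurable [set x | e < mdist (r x) (r' x)].
Proof.
move=> [vtL vtD] br br'.
pose L (n j : nat) := forall a b, `|vt j a - vt j b| <= mdist a b + n.+1%:R^-1.
(* The threshold is raised by exactly the slack allowed in [L n], so membership forces the distance
   above [e]. *)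
pose S (n j : nat) := [set x | e + n.+1%:R^-1 < `|vt j (r x) - vt j (r' x)|].
rewrite (_ : [set x | _] = \bigcup_n \bigcup_(j in L n) S n j).
  apply: bigcup_measurable => n _; apply: bigcup_measurable => j _.
  have cvt := lipschitz_continuous _ (vtL j).
  apply: measurable_set_ltr => //; apply: measurableT_comp => //.
  by apply: measurable_funB; exact: measurable_fun_comp_borel.
apply/seteqP; split => x /=; last first.
  by move=> [n _ [j Lnj]] /lt_le_trans/(_ (Lnj _ _)); rewrite ltrD2r.
(* The witness [vt j] approximates the distance to [r' x] within [h / 2], where [h = 1 / (n + 1)].
   It is 1-Lipschitz up to [h], and its increment is at least the distance minus [h], hence above
   [e + h] because [h < t]. *)
move=> ex; pose t := (mdist (r x) (r' x) - e) / 4.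
have t0 : 0 < t by rewrite /t; lra.
pose n := Num.truncn (t^-1).
have nt : n.+1%:R^-1 < t.
  by rewrite invf_plt ?posrE// truncnS_gt.
have n0 : 0 < n.+1%:R^-1 / 2 :> R by rewrite divr_gt0.
have [j vj] := vtD _ (lipschitz_continuous _ (lipschitz_mdist (r' x))) _ n0.
exists n => //; exists j => [a b|]; rewrite /S /=; set h := _^-1 in nt n0 vj *.
  have := metric_triangle a b (r' x); have := metric_triangle b a (r' x).
  rewrite (metric_sym b a).
  move: (vj a) (vj b); rewrite !ltr_norml ler_norml.
  by move=> /andP[? ?] /andP[? ?] ? ?; apply/andP; split; lra.
move: (vj (r x)) (vj (r' x)); rewrite mdistxx !ltr_norml.
move=> /andP[? ?] /andP[? ?]; apply: lt_le_trans (ler_norm _).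
by move: nt t0; rewrite /t; lra.
Qed.

(** On the set [S] where the displacement exceeds [t] the integrand is bounded and [mu S] is small;
    off [S] the Lipschitz bound applies. The scales [t] and [e / (4 * (|B| + 1))] give [e / 2]
    each. *)
Lemma asympt_invariant_integral {d} {X : measurableType d}
    (mu : probability X R) (T : X -> X) (vt : nat -> E -> R)
    (r : nat -> X -> E) f :
  measure_preserving mu T -> compact [set: E] -> dense_lipschitz_seq vt ->
  (forall l, borel_measurable (r l)) -> asympt_invariant_in_measure mu T r ->
  lipschitz_fun f ->
  \int[mu]_x `|f (r l (T x)) - f (r l x)| @[l --> \oo] --> (0 : R).
Proof.
move=> [mT muT] cE dvt br rT fL; have cf := lipschitz_continuous _ fL.
have [B fB] := compact_bounded_fun _ cE cf.
have brT l : borel_measurable (fun x => r l (T x)).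
  move=> A sA; rewrite -[X in measurable X]setTI.
  by apply: (mT measurableT _ (br l A sA)).
have [k fk] := fL; apply/cvgrPdist_le => e e0.
have k0 : 0 < `|k| + 1 by rewrite ltr_wpDl.
have B0 : 0 < `|B| + 1 by rewrite ltr_wpDl.
pose t := e / 2 / (`|k| + 1); have t0 : 0 < t by rewrite !divr_gt0.
have e4 : 0 < e / (4 * (`|B| + 1)) by rewrite divr_gt0// mulr_gt0.
have /fine_cvg/cvgrPdist_le/(_ _ e4) := rT _ t0.
apply: filterS => l; rewrite !sub0r !normrN /=.
set S := [set x | _]; move=> /(le_trans (ler_norm _)) muS.
have mS : measurable S by exact: measurable_mdist_gt dvt (brT l) (br l).
have bf (q : X -> E) : borel_measurable q ->
    bounded_measurable (fun x => f (q x)).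
  by move=> bq; split; [exact: measurable_fun_comp_borel|exists B].
have bd := bounded_measurable_norm _
  (bounded_measurableB _ _ (bf _ (brT l)) (bf _ (br l))).
rewrite ger0_norm; last exact: Rintegral_ge0.
apply: (@le_trans _ _ (\int[mu]_x (e / 2 + 2 * (`|B| + 1) * \1_S x))).
  have bS := bounded_measurable_indic _ mS.
  apply: bintegral_le => // [|x].
    apply: bounded_measurableD; first exact: bounded_measurable_cst.
    by apply: bounded_measurableM => //; exact: bounded_measurable_cst.
  rewrite indicE; have [xS|xS] := boolP (x \in S).
    rewrite mulr1; apply: le_trans (ler_normB _ _) _.
    have := fB (r l (T x)); have := fB (r l x); have := ler_norm B; lra.
  rewrite mulr0 addr0; apply: le_trans (fk _ _) _.
  have xt : mdist (r l (T x)) (r l x) <= t.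
    by rewrite leNgt; apply/negP => tx; move/negP: xS; apply; rewrite inE.
  apply: (@le_trans _ _ ((`|k| + 1) * mdist (r l (T x)) (r l x))).
    by rewrite ler_wpM2r ?mdist_ge0// (le_trans (ler_norm _))// lerDl.
  by rewrite mulrC -ler_pdivlMr.
have bS := bounded_measurable_indic _ mS.
rewrite bintegralD; last 2 first.
- exact: bounded_measurable_cst.
- by apply: bounded_measurableM => //; exact: bounded_measurable_cst.
rewrite bintegral_cst bintegralZl// bintegral_indic//.
move: muS; rewrite ler_pdivlMr ?mulr_gt0//; lra.
Qed.

Lemma lipschitz_chi (vt : nat -> E -> R) j :
  lipschitz_fun (vt j) -> lipschitz_fun (chi vt j).
Proof.
move=> [k vk]; rewrite /chi; set s := sup _; exists (k / `|s|) => x y.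
by rewrite -mulrBl normrM normfV mulrAC ler_wpM2r// invr_ge0.
Qed.

Lemma chi_le1 (vt : nat -> E -> R) j x : compact [set: E] ->
  continuous (vt j) -> `|chi vt j x| <= 1.
Proof.
move=> cE cvt; have [B vB] := compact_bounded_fun _ cE cvt.
rewrite /chi; set s := sup _.
(* Compactness bounds [vt j], so [s] is a true supremum. If [s = 0], the inverse of zero being zero,
   [chi vt j] vanishes. *)
have vs : `|vt j x| <= s.
  by apply: ub_le_sup; [exists B => _ [y _ <-]|exists x].
rewrite normrM normfV; have [->|s0] := eqVneq s 0.
  by rewrite normr0 invr0 mulr0.
by rewrite ler_pdivrMr ?normr_gt0// mul1r (le_trans vs)// ler_norm.
Qed.

End compact_metric.

(** * Limits of dyadically weighted series with a small head *)

Section dyadic_series.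
Context {R : realType}.
Context (a : nat -> R) (e : R) (N : nat).
Context (a_ge0 : forall j, 0 <= a j) (a_le2 : forall j, a j <= 2).
Context (a_le : forall j, (j < N)%N -> a j <= e) (e_ge0 : 0 <= e).

Let u j := (2 ^+ j.+1)^-1 * a j.

Lemma dyadic_series_nondecreasing : nondecreasing_seq (series u).
Proof.
apply/nondecreasing_seqP => n; rewrite !seriesEnat/= big_nat_recr//= lerDl.
by rewrite mulr_ge0.
Qed.

(** The bounds [head] and [tail] keep the exact partial sums of the weights, which makes them
    inductive. *)
Lemma dyadic_series_le n : series u n <= e + 2 * (2 ^+ N)^-1.
Proof.
have p0 m : 0 <= (2 ^+ m)^-1 :> R by [].
have p2 m : (2 ^+ m)^-1 = 2 * (2 ^+ m.+1)^-1 :> R.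
  by rewrite exprS invfM mulrA divff// mul1r.
have uS m : series u m.+1 = series u m + u m.
  by rewrite !seriesEnat/= big_nat_recr.
have head m : (m <= N)%N -> series u m <= e * (1 - (2 ^+ m)^-1).
  elim: m => [_|m IH mN].
    by rewrite seriesEnat/= big_nil expr0 invr1 subrr mulr0.
  have := ler_wpM2l (p0 m.+1) (a_le _ mN).
  by have := IH (ltnW mN); rewrite uS (p2 m) /u; lra.
have tail m : series u (N + m)%N <= e + 2 * ((2 ^+ N)^-1 - (2 ^+ (N + m)%N)^-1).
  elim: m => [|m IH].
    rewrite addn0 subrr mulr0 addr0; apply: le_trans (head _ (leqnn _)) _.
    by have := mulr_ge0 e_ge0 (p0 N); lra.
  have := ler_wpM2l (p0 (N + m).+1%N) (a_le2 (N + m)%N).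
  by move: IH; rewrite addnS uS (p2 (N + m)%N) /u; lra.
(* Passing to index [N + n] avoids comparing [n] with [N]. *)
apply: le_trans (dyadic_series_nondecreasing _ _ (leq_addl N n)) _.
by apply: le_trans (tail n) _; have := p0 (N + n)%N; lra.
Qed.

Lemma dyadic_series_lim : 0 <= limn (series u) <= e + 2 * (2 ^+ N)^-1.
Proof.
(* Convergence comes first: bounds on partial sums pass to [limn] only for a convergent series. *)
have cu : cvgn (series u).
  apply: nondecreasing_is_cvgn; first exact: dyadic_series_nondecreasing.
  by exists (e + 2 * (2 ^+ N)^-1) => _ [n _ <-]; exact: dyadic_series_le.
apply/andP; split.
  apply: limr_ge => //; apply: nearW => n; rewrite seriesEnat/=.
  by apply: sumr_ge0 => j _; rewrite mulr_ge0.
by apply: limr_le => //; apply: nearW => n; exact: dyadic_series_le.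
Qed.

End dyadic_series.

(** * Uniform convergence of [D_E] and transfer of weak limits *)

Lemma near_forall_ltn (P : nat -> set nat) (N : nat) :
  (forall j, \forall l \near \oo, P j l) ->
  \forall l \near \oo, forall j, (j < N)%N -> P j l.
Proof.
move=> nP; elim: N => [|N IH]; first exact: nearW.
apply: filterS2 IH (nP N) => l PN PNl j.
by rewrite ltnS leq_eqVlt => /predU1P[->|/PN].
Qed.

Theorem mainTheorem10 (R : realType) (d : measure_display) (X : measurableType d)
  (mu : probability X R) (T : X -> X) (E : metricType R)
  (vt : nat -> E -> R) (Rl : nat -> X -> E) (K : set (probability X R)) :
  measure_preserving mu T -> ergodic mu T ->
  compact [set: E] ->
  dense_lipschitz_seq vt ->
  (forall l, borel_measurable (Rl l)) ->
  asympt_invariant_in_measure mu T Rl ->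
  dP_compact mu K ->
  (fun l => sup [set D_E vt nu nu' (Rl l) | nu in K & nu' in K]) @ \oo --> 0
  /\
  (forall (dO : measure_display) (Omega : measurableType dO)
     (P : probability Omega R) (Rlim : Omega -> E)
     (nul nul' : nat -> probability X R),
     borel_measurable Rlim ->
     (forall l, K (nul l)) -> (forall l, K (nul' l)) ->
     weak_conv nul' Rl P Rlim -> weak_conv nul Rl P Rlim).
Proof.
move=> mp erg cE dvt bR Rinv cK.
(* Serves both conclusions: for [chi vt j] in the metric statement and for [vt j] in the weak
   one. *)
have unif (f : E -> R) (e : R) : lipschitz_fun f -> 0 < e ->
    \forall l \near \oo, forall nu nu', K nu -> K nu' ->
      `|law_int nu (Rl l) f - law_int nu' (Rl l) f| <= e.
  move=> fL; have cf := lipschitz_continuous _ fL.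
  have [B fB] := compact_bounded_fun _ cE cf.
  apply: (asymptotic_law_uniform _ _ (fun l x => f (Rl l x)) B _ _ mp erg cK).
  - by move=> l; exact: measurable_fun_comp_borel.
  - by move=> l x.
  - exact: asympt_invariant_integral mp cE dvt bR Rinv fL.
have bfR (f : E -> R) l : continuous f -> bounded_measurable (f \o Rl l).
  move=> cf; have [B fB] := compact_bounded_fun _ cE cf.
  by split; [exact: measurable_fun_comp_borel|exists B => x; exact: fB].
have [vtL vtD] := dvt; have vtC j := lipschitz_continuous _ (vtL j).
split.
  apply/cvgrPdist_le => e e0.
  have e2 : 0 < e / 2 by lra.
  (* Beyond [N] the weights are small enough for the trivial bound [2] on each difference; the first
     [N] test functions are handled by [unif]. *)
  have [N Ne] : exists N : nat, 2 * (2 ^+ N)^-1 <= e / 2.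
    exists (Num.truncn (4 / e)); set n := Num.truncn _.
    have n4 : 4 / e < 2 ^+ n.
      apply: lt_le_trans (truncnS_gt _) _.
      by rewrite -natrX ler_nat ltn_expl.
    move: n4; rewrite ltr_pdivrMr// => n4.
    by rewrite ler_pdivrMr ?exprn_gt0//; lra.
  have := near_forall_ltn _ N (fun j => unif _ _ (lipschitz_chi _ _ (vtL j)) e2).
  apply: filterS => l unifl; rewrite sub0r normrN.
  have DE nu nu' : K nu -> K nu' -> 0 <= D_E vt nu nu' (Rl l) <= e.
    move=> Knu Knu'.
    have chi1 (p : probability X R) j : `|law_int p (Rl l) (chi vt j)| <= 1.
      apply: bintegral_norm_le_cst => [|x]; last exact: chi_le1.
      exact/bfR/lipschitz_continuous/lipschitz_chi.
    have /andP[D0 De] := @dyadic_series_lim R (fun j =>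
      `|law_int nu (Rl l) (chi vt j) - law_int nu' (Rl l) (chi vt j)|) (e / 2) N
      (fun=> normr_ge0 _)
      (fun j => le_trans (ler_normB _ _) (lerD (chi1 nu j) (chi1 nu' j)))
      (fun j jN => unifl j jN _ _ Knu Knu') (ltW e2).
    by rewrite /D_E D0/=; apply: le_trans De _; lra.
  set S := [set D_E vt nu nu' (Rl l) | nu in K & nu' in K].
  (* If [K] is empty, so is [S], and [sup] takes its default value [0]. *)
  have [S0|/set0P S0] := eqVneq S set0; first by rewrite S0 sup0 normr0 ltW.
  have Se : ubound S e.
    by move=> _ [nu Knu [nu' Knu' <-]]; have /andP[] := DE _ _ Knu Knu'.
  rewrite ger0_norm; first exact: ge_sup.
  have [_ [nu Knu [nu' Knu' _]]] := S0; have /andP[D0 _] := DE _ _ Knu Knu'.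
  apply: le_trans D0 _; apply: ub_le_sup; first by exists e.
  by exists nu => //; exists nu'.
move=> dO Omega P Rlim nul nul' _ Knul Knul' wc f cf.
apply/cvgrPdist_le => e e0; have e4 : 0 < e / 4 by lra.
(* Density replaces [f] by a Lipschitz [vt j]. The four quarters are this replacement under [nul l]
   and under [nul' l], the uniform comparison, and the assumed weak convergence. *)
have [j vj] := vtD _ cf _ e4.
have /cvgrPdist_le/(_ _ e4) := wc _ cf; have := unif _ _ (vtL j) e4.
apply: filterS2 => l /(_ _ _ (Knul l) (Knul' l)) + Rlf.
have approx (p : probability X R) :
    `|law_int p (Rl l) f - law_int p (Rl l) (vt j)| <= e / 4.
  rewrite /law_int -bintegralB; [|exact: bfR..].
  apply: bintegral_norm_le_cst => [|x]; last exact: ltW (vj _).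
  by apply: bounded_measurableB; exact: bfR.
move: Rlf (approx (nul l)) (approx (nul' l)); rewrite !ler_norml.
move=> /andP[? ?] /andP[? ?] /andP[? ?] /andP[? ?]; apply/andP; split; lra.
Qed.
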